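(* Let $n\ge 3$ and let $A$, $B$ be real symmetric positive semidefinite $n\times n$ matrices with $B=\Sigma(A)$ for some hypomorphism $\Sigma$. Suppose that $A$ and $B$ both have presentations in good position. Then the kernels of $A$ and $B$ coincide and are one dimensional: $\mathrm{eigen}_0(A)=\mathrm{eigen}_0(B)\cong\mathbb R$.
   Context: For an $n\times n$ matrix $M$, $M_i$ denotes the matrix obtained by deleting the $i$-th row and column. $B=\Sigma(A)$ (hypomorphic) means there exist $(n-1)\times(n-1)$ permutation matrices $\sigma_1,\dots,\sigma_n$ with $B_i=\sigma_iA_i\sigma_i^t$ for all $i$. For a real symmetric positive semidefinite $A=(a_{ij})$, a presentation is an ordered set $U=\{u_1,\dots,u_n\}\subset\mathbb R^n$ with $(u_i,u_j)=a_{ij}$. $U$ is in good position if its convex hull has dimension $n-1$ and contains the origin in its interior (relative to its affine hull). $\mathrm{eigen}_0(M)$ denotes the eigenspace of $M$ for the eigenvalue $0$. *)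

(* Defs.v *)
From HB Require Import structures.
From mathcomp Require Import all_boot all_order all_fingroup all_algebra.
From mathcomp Require Import boolp classical_sets reals.
From mathcomp Require Import topology normedtype convex.

Set Implicit Arguments.
Unset Strict Implicit.
Unset Printing Implicit Defensive.

Import Order.TTheory GRing.Theory Num.Theory.
Import numFieldNormedType.Exports.

Local Open Scope classical_set_scope.
Local Open Scope ring_scope.

Definition principal_submx (R : realType) (n : nat) (i : 'I_n) (M : 'M[R]_n) :
    'M[R]_n.-1 :=
  row' i (col' i M).

Definition hypomorphic (R : realType) (n : nat) (A B : 'M[R]_n) : Prop :=
  exists s : 'I_n -> 'S_n.-1, forall i : 'I_n,
    principal_submx i B =
      perm_mx (s i) *m principal_submx i A *m (perm_mx (s i))^T.

Definition sym_psd (R : realType) (n : nat) (A : 'M[R]_n) : Prop :=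
  A^T = A /\ forall x : 'cV[R]_n, 0 <= (x^T *m A *m x) 0 0.

Definition inner (R : realType) (n : nat) (u v : 'rV[R]_n) : R :=
  \sum_(k < n) u 0 k * v 0 k.

Definition presentation (R : realType) (n : nat) (A : 'M[R]_n)
    (u : 'I_n -> 'rV[R]_n) : Prop :=
  forall i j : 'I_n, inner (u i) (u j) = A i j.

Definition convex_hull (R : realType) (n : nat) (S : set 'rV[R]_n) :
    set 'rV[R]_n :=
  smallest (@convex_set R 'rV[R]_n) S.

Definition affine_set (R : realType) (n : nat) (S : set 'rV[R]_n) : Prop :=
  forall (x y : 'rV[R]_n) (t : R), S x -> S y -> S ((1 - t) *: x + t *: y).

Definition affine_hull (R : realType) (n : nat) (S : set 'rV[R]_n) :
    set 'rV[R]_n :=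
  smallest (@affine_set R n) S.

(* The dimension of a nonempty set is that of the direction space of its
   affine hull; the empty set has no dimension in this sense. *)
Definition has_dimension (R : realType) (n : nat) (S : set 'rV[R]_n) (d : nat) :
    Prop :=
  exists (p : 'rV[R]_n) (V : {vspace 'rV[R]_n}),
    affine_hull S = [set p + v | v in [set` V]] /\ (\dim V)%VS = d.

(* The conjunct [S x] is needed: [within D (nbhs x) S] holds vacuously when x
   is not in the closure of D. *)
Definition relative_interior (R : realType) (n : nat) (S : set 'rV[R]_n) :
    set 'rV[R]_n :=
  [set x | S x /\ within (affine_hull S) (nbhs x) S].

Definition good_position (R : realType) (n : nat) (u : 'I_n -> 'rV[R]_n) :
    Prop :=
  has_dimension (convex_hull (range u)) n.-1 /\
  relative_interior (convex_hull (range u)) 0.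

(* Main.v *)
Require Import Defs.
From mathcomp Require Import all_boot all_order all_fingroup all_algebra.
From mathcomp Require Import boolp classical_sets reals.
From mathcomp Require Import topology normedtype convex.
From mathcomp Require Import interval_inference ring.

(** Good position makes the kernel of the Gram matrix a line spanned by a vector
    [a] with positive entries. The adjugate of a symmetric matrix with kernel
    spanned by [a] is [c a^T a], so the principal minors of size [n - 1] are
    [c a_i ^ 2], and they do not vanish. A hypomorphism preserves these minors;
    hence they determine [a], by positivity, up to a scalar. *)

Set Implicit Arguments.
Unset Strict Implicit.
Unset Printing Implicit Defensive.

Import Order.TTheory GRing.Theory Num.Theory.
Import numFieldNormedType.Exports.

Local Open Scope ring_scope.

(** * Kernels of Gram matrices and principal minors *)

Lemma mulmx_tr_eq0 (R : realDomainType) (m : nat) (y : 'rV[R]_m) :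
  y *m y^T = 0 -> y = 0.
Proof.
move=> /matrixP/(_ 0 0); rewrite !mxE => y0.
apply/rowP => k; rewrite mxE; apply/eqP; rewrite -sqrf_eq0; apply/eqP.
have: \sum_j y 0 j ^+ 2 = 0.
  by rewrite -[RHS]y0; apply: eq_bigr => j _; rewrite mxE expr2.
by move/psumr_eq0P; apply=> // j _; rewrite sqr_ge0.
Qed.

(** The squared length of [x *m U] is [x *m (U *m U^T) *m x^T], which vanishes. *)
Lemma mulmx_gram_eq0 (R : realDomainType) (p m : nat) (U : 'M[R]_(p, m))
  (x : 'rV[R]_p) : x *m (U *m U^T) = 0 -> x *m U = 0.
Proof.
move=> xU; apply: mulmx_tr_eq0.
by rewrite trmx_mul -mulmxA [U *m _]mulmxA mulmxA xU mul0mx.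
Qed.

Lemma kermx_gram (R : realFieldType) (p m : nat) (U : 'M[R]_(p, m)) :
  (kermx (U *m U^T) :=: kermx U)%MS.
Proof.
apply/eqmxP/andP; split; apply/rV_subP => x /sub_kermxP xU; apply/sub_kermxP.
  exact: mulmx_gram_eq0 xU.
by rewrite mulmxA xU mul0mx.
Qed.

(** A kernel vector of the submatrix, extended by a zero at [i], is killed by [U], hence is a
    multiple of [a]. Its entry at [i] vanishes while [a 0 i] does not, so the multiple is zero. *)
Lemma principal_minor_gram_neq0 (R : realType) (n m : nat) (U : 'M[R]_(n, m))
    (a : 'rV[R]_n) (i : 'I_n) :
  (kermx U :=: a)%MS -> a 0 i != 0 -> \det (principal_submx i (U *m U^T)) != 0.
Proof.
move=> kerU ai; apply/negP => /det0P[x /negP xn0].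
have -> : principal_submx i (U *m U^T) = row' i U *m (row' i U)^T.
  by apply/matrixP => k l; rewrite !mxE; apply: eq_bigr => j _; rewrite !mxE.
move=> /mulmx_gram_eq0 xU; apply: xn0.
pose y : 'rV[R]_n := x *m row' i 1%:M.
have yl k : y 0 (lift i k) = x 0 k.
  rewrite !mxE (bigD1 k) //= !mxE eqxx mulr1 big1 ?addr0 // => l lk.
  by rewrite !mxE (inj_eq lift_inj) (negPf lk) mulr0.
have yi : y 0 i = 0.
  rewrite !mxE big1 // => l _.
  by rewrite !mxE eq_sym (negPf (neq_lift _ _)) mulr0.
have /sub_rVP[c yE] : (y <= a)%MS.
  rewrite -kerU; apply/sub_kermxP.
  by rewrite -mulmxA row'Esub mul_rowsub_mx mul1mx -row'Esub.
have c0 : c = 0.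
  by move/eqP: yi; rewrite yE mxE mulf_eq0 (negPf ai) orbF => /eqP.
by apply/eqP/rowP => k; rewrite -yl yE c0 scale0r !mxE.
Qed.

(* When the kernel is a line spanned by [a], symmetry forces the adjugate to be
   a scalar multiple of [a^T *m a]; its diagonal consists of principal minors. *)
Lemma principal_minor_ratio (R : realType) (n : nat) (A : 'M[R]_n)
    (a : 'rV[R]_n) (i j : 'I_n) :
  A^T = A -> (kermx A :=: a)%MS -> a != 0 ->
  \det (principal_submx i A) * a 0 j ^+ 2 =
  \det (principal_submx j A) * a 0 i ^+ 2.
Proof.
move=> symA kerA a0.
have det0 : \det A = 0.
  apply/eqP/det0P; exists a => //; apply/sub_kermxP.
  by rewrite kerA.
have adjr k : exists c, row k (\adj A) = c *: a.
  apply/sub_rVP; rewrite -kerA; apply/sub_kermxP.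
  by rewrite -row_mul mul_adj_mx det0 raddf0 row0.
have minorE k : \det (principal_submx k A) = (\adj A) k k.
  by rewrite mxE /cofactor addnn -signr_odd odd_double mul1r /principal_submx.
have adj_sym : (\adj A) i j = (\adj A) j i.
  by rewrite -[in LHS]symA -trmx_adj mxE.
have [[c ci] [d dj]] := (adjr i, adjr j).
have adji k : (\adj A) i k = c * a 0 k by move/rowP/(_ k): ci; rewrite !mxE.
have adjj k : (\adj A) j k = d * a 0 k by move/rowP/(_ k): dj; rewrite !mxE.
move: adj_sym; rewrite !minorE !adji !adjj => cd.
transitivity (c * a 0 j * a 0 i * a 0 j); first by ring.
by rewrite cd; ring.
Qed.

Lemma det_principal_hypomorphic (R : realType) (n : nat) (A B : 'M[R]_n)
    (i : 'I_n) :
  hypomorphic A B ->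
  \det (principal_submx i B) = \det (principal_submx i A).
Proof.
case=> s ->; rewrite !det_mulmx det_tr mulrAC !det_perm -expr2 sqrr_sign.
by rewrite mul1r.
Qed.

(** * Presentations, convex hulls and affine hulls *)

Lemma presentation_gram (R : realType) (n : nat) (A : 'M[R]_n)
    (u : 'I_n -> 'rV[R]_n) :
  presentation A u -> A = (\matrix_i u i) *m (\matrix_i u i)^T.
Proof.
move=> Au; apply/matrixP => i j; rewrite -Au !mxE.
by apply: eq_bigr => k _; rewrite !mxE.
Qed.

(** The cone generated by the [u i] is convex and contains them, so it contains their hull. *)
Lemma convex_hull_nonneg_combination (R : realType) (n : nat)
    (u : 'I_n -> 'rV[R]_n) (x : 'rV[R]_n) :
  convex_hull (range u) x ->
  exists2 t : 'rV[R]_n, forall j, 0 <= t 0 j & x = t *m \matrix_i u i.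
Proof.
pose cone := [set y | exists2 t : 'rV[R]_n,
  forall j, 0 <= t 0 j & y = t *m \matrix_i u i]%classic.
apply: (@smallest_sub _ _ _ cone) => /=.
  move=> {}x y l; rewrite !inE /= => -[t t0 ->] [s s0 ->].
  exists (l%:num *: t + (1 - l%:num) *: s).
    by move=> j; rewrite !mxE addr_ge0 // mulr_ge0.
  by rewrite mulmxDl -!scalemxAl.
move=> _ [i _ <-]; exists (delta_mx 0 i) => [j|]; first by rewrite mxE ler0n.
by rewrite -rowE rowK.
Qed.

Lemma affine_affine_hull (R : realType) (n : nat) (S : set 'rV[R]_n) :
  affine_set (affine_hull S).
Proof.
move=> x y t Sx Sy T TP; have [affT _] := TP.
by apply: affT; [exact: Sx|exact: Sy].
Qed.

(** * The kernel of a configuration in good position *)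

Section GoodPosition.

Variables (R : realType) (n : nat) (u : 'I_n -> 'rV[R]_n).
Hypothesis u_good : good_position u.

Let U : 'M[R]_n := \matrix_i u i.
Let hull := convex_hull (range u).

Lemma affine_hull_vertex i : affine_hull hull (u i).
Proof. by apply: sub_gen_smallest; apply: sub_gen_smallest; exists i. Qed.

Lemma affine_hull_origin : affine_hull hull 0.
Proof. by case: u_good => _ [h0 _]; apply: sub_gen_smallest; apply: h0. Qed.

(** Relative interiority only speaks of points of the affine hull; this puts the test points
    [- e *: u i] there. *)
Lemma affine_hull_scale_vertex i t : affine_hull hull (t *: u i).
Proof.
have := @affine_affine_hull R n hull _ _ t affine_hull_origin
  (affine_hull_vertex i).
by rewrite scaler0 add0r.
Qed.

Lemma affine_hull_row_space x : affine_hull hull x -> (x <= U)%MS.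
Proof.
apply: (@smallest_sub _ _ _ [set y | (y <= U)%MS]%classic) =>
  [{}x y t /= xU yU|{}x].
  by rewrite addmx_sub // scalemx_sub.
by move=> /convex_hull_nonneg_combination[t _ ->]; apply: submxMl.
Qed.

(** The affine hull passes through the origin, so it is the row space of [U], of dimension [n.-1];
    rank-nullity leaves a kernel of dimension one. *)
Lemma kernel_dimension : (0 < n)%N ->
  exists w : 'rV[R]_n, forall x, x *m U = 0 -> exists c, x = c *: w.
Proof.
move=> n_gt0; case: u_good => -[p [V [hullE dimV]]] _.
(* Since the origin is some [p + v], the translate of [V] by [p] is [V] itself. *)
have pV : p \in V.
  have := affine_hull_origin; rewrite hullE => -[v /= vV pv].
  by rewrite -(addrK v p) pv sub0r rpredN.
have mulVE : limg (linfun (mulmxr U : 'rV[R]_n -> 'rV[R]_n)) = V.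
  apply/vspaceP => x; apply/idP/idP.
    move=> /memv_imgP[y _ ->]; rewrite lfunE /= mulmx_sum_row.
    apply: rpred_sum => i _; apply: rpredZ; rewrite rowK.
    have := affine_hull_vertex i; rewrite hullE => -[v /= vV <-].
    exact: rpredD.
  move=> xV; have /submxP[y ->] : (x <= U)%MS.
    apply: affine_hull_row_space; rewrite hullE; exists (x - p) => /=.
      exact: rpredB.
    by rewrite addrC subrK.
  rewrite -[y *m U](lfunE (mulmxr U : {linear 'rV[R]_n -> 'rV[R]_n})).
  by rewrite memv_img ?memvf.
have := limg_ker_dim (linfun (mulmxr U : 'rV[R]_n -> 'rV[R]_n)) fullv.
rewrite mulVE dimV capfv dimvf dim_matrix mul1r -[RHS](prednK n_gt0).
rewrite -[n.-1.+1]add1n => /eqP; rewrite eqn_add2r => /eqP dim1.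
set K := lker _ in dim1.
exists (vpick K) => x xU; apply/vlineP.
suff <- : K = <[vpick K]>%VS by rewrite memv_ker lfunE /= xU.
apply/eqP; rewrite eq_sym eqEdim -memvE memv_pick dim1 dim_vline vpick0.
by rewrite -dimv_eq0 dim1.
Qed.

(* The origin can be left slightly in the direction [- u i] without leaving the
   hull; the point reached is both [- e *: u i] and a nonnegative combination. *)
Lemma kernel_nonneg_vector i :
  exists a : 'rV[R]_n,
    [/\ a *m U = 0, forall j, 0 <= a 0 j & 0 < a 0 i].
Proof.
have [e e0 he] : exists2 e : R, 0 < e & hull (- e *: u i).
  case: u_good => _ [_]; rewrite /within /= => nh.
  have cu : ((fun e : R => - e *: u i) @ (0 : R) --> (0 : 'rV[R]_n))%classic.
    rewrite -[X in (_ --> X)%classic](scale0r (u i)) -[X in X *: u i]oppr0.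
    apply: (@cvgZr_tmp R 'rV[R]_n R _ _ (fun e => - e)).
    by apply: (@cvgN R R R _ _ id).
  have [d /= d0 hd] := cu _ nh.
  exists (d / 2); first by rewrite divr_gt0.
  apply: (hd (d / 2)); last exact: affine_hull_scale_vertex.
  rewrite /ball /= sub0r normrN gtr0_norm ?divr_gt0 //.
  by rewrite ltr_pdivrMr // ltr_pMr // ltr1n.
have [t t0 tE] := convex_hull_nonneg_combination he.
exists (t + e *: delta_mx 0 i); split.
- by rewrite mulmxDl -tE -scalemxAl -rowE rowK -scalerDl addNr scale0r.
- by move=> j; rewrite !mxE addr_ge0 // mulr_ge0 ?ler0n // ltW.
- by rewrite !mxE !eqxx mulr1 ltr_wpDl.
Qed.

(** In the sum of the nonnegative kernel vectors attached to all [i], each coordinate has a positive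
    contribution. *)
Lemma kernel_positive_vector :
  exists a : 'rV[R]_n, a *m U = 0 /\ forall j, 0 < a 0 j.
Proof.
have [f fP] := choice kernel_nonneg_vector.
exists (\sum_i f i); split.
  by rewrite mulmx_suml big1 // => i _; case: (fP i).
move=> j; rewrite summxE (bigD1 j) //= ltr_wpDr //; last by case: (fP j).
by apply: sumr_ge0 => i _; case: (fP i).
Qed.

(** As [0 < n], a positive kernel vector is nonzero, so it spans the line containing the kernel. *)
Lemma kermx_positive_line : (0 < n)%N ->
  exists2 a : 'rV[R]_n, forall j, 0 < a 0 j & (kermx U :=: a)%MS.
Proof.
move=> n_gt0; have [a [aU a_gt0]] := kernel_positive_vector.
exists a => //; have [w wP] := kernel_dimension n_gt0.
apply/eqmxP/andP; split; last exact/sub_kermxP.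
apply/rV_subP => x /sub_kermxP /wP[c ->].
have [d ad] := wP a aU.
have d0 : d != 0.
  apply/eqP => d0; have := a_gt0 (Ordinal n_gt0).
  by rewrite ad d0 scale0r mxE ltxx.
by rewrite scalemx_sub // ad (eqmx_scale _ d0).
Qed.

End GoodPosition.

Unset Implicit Arguments.

(* [eigenspace] consists of row vectors v with v *m A = 0 *: v; as A and B are
   symmetric, these are the transposes of the column vectors of the kernel. *)
Theorem theorem3 (R : realType) (n : nat) (A B : 'M[R]_n)
  (n_ge3 : (3 <= n)%N)
  (A_psd : sym_psd A) (B_psd : sym_psd B)
  (AB_hypo : hypomorphic A B)
  (A_good : exists u : 'I_n -> 'rV[R]_n, presentation A u /\ good_position u)
  (B_good : exists u : 'I_n -> 'rV[R]_n, presentation B u /\ good_position u) :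
  (eigenspace A 0 :=: eigenspace B 0)%MS /\ \rank (eigenspace A 0) = 1%N.
Proof.
have n_gt0 : (0 < n)%N by apply: leq_trans n_ge3.
pose o := Ordinal n_gt0.
case: A_good => u [uA /(kermx_positive_line) /(_ n_gt0) [a a_gt0 aE]].
case: B_good => v [vB /(kermx_positive_line) /(_ n_gt0) [b b_gt0 bE]].
have neq0 (c : 'rV[R]_n) : (forall j, 0 < c 0 j) -> c != 0.
  by move=> c_gt0; apply/eqP => c0; have := c_gt0 o; rewrite c0 mxE ltxx.
have kerA : (kermx A :=: a)%MS.
  rewrite (presentation_gram uA).
  exact: eqmx_trans (kermx_gram _) aE.
have kerB : (kermx B :=: b)%MS.
  rewrite (presentation_gram vB).
  exact: eqmx_trans (kermx_gram _) bE.
have minor_neq0 i : \det (principal_submx i A) != 0.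
  rewrite (presentation_gram uA).
  by apply: principal_minor_gram_neq0 aE _; rewrite gt_eqF.
have ab i j : a 0 i * b 0 j = a 0 j * b 0 i.
  (* Both sides are nonnegative, so it suffices to compare squares, which the minors control. *)
  apply/eqP; rewrite -(@eqrXn2 _ 2) // ?mulr_ge0 // ?ltW //.
  have := principal_minor_ratio i j A_psd.1 kerA (neq0 a a_gt0).
  have := principal_minor_ratio i j B_psd.1 kerB (neq0 b b_gt0).
  rewrite !(det_principal_hypomorphic _ AB_hypo).
  set x := \det _; set y := \det _ => bxy axy; rewrite !exprMn.
  (* Multiplying by the nonzero [x * y] lets the ratio identities for [A] and [B], which share these
     minors, be multiplied together. *)
  rewrite -(inj_eq (mulfI (mulf_neq0 (minor_neq0 i) (minor_neq0 j)))) -/x -/y.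
  apply/eqP; transitivity ((y * a 0 i ^+ 2) * (x * b 0 j ^+ 2)); first by ring.
  by rewrite -axy bxy; ring.
have abE : a = (a 0 o / b 0 o) *: b.
  apply/rowP => j; rewrite mxE mulrAC -ab mulfK //.
  by rewrite gt_eqF.
have -> : eigenspace A 0 = kermx A by rewrite /eigenspace raddf0 subr0.
have -> : eigenspace B 0 = kermx B by rewrite /eigenspace raddf0 subr0.
split; last by rewrite kerA rank_rV neq0.
apply: eqmx_trans kerA (eqmx_trans _ (eqmx_sym kerB)).
by rewrite abE; apply: eqmx_scale; rewrite mulf_neq0 ?invr_eq0 ?gt_eqF.
Qed.
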